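(* Let $X$ be a topological space. The compact-clopen game on $X$ is equivalent to the $\mathcal{K}$-quasi-component-clopen game on $X$.
   Context: A set is clopen if it is both open and closed. A subset $F$ of $X$ is called a quasi-component of a compact subset $K$ of $X$ if $F=\bigcap\{U : U \text{ is clopen in } X,\ K\subseteq U\}$. The compact-clopen game on $X$: in each inning $n\in\omega$, ONE picks a compact set $K_n\subseteq X$, and then TWO chooses a clopen set $U_n\subseteq X$ with $K_n\subseteq U_n$. ONE wins the play if $X\subseteq\bigcup_{n\in\omega}U_n$; otherwise TWO wins. The $\mathcal{K}$-quasi-component-clopen game on $X$: in each inning $n\in\omega$, ONE picks a set $A_n$ that is the quasi-component of some compact subset $K_n$ of $X$, and then TWO chooses a clopen set $U_n\subseteq X$ with $A_n\subseteq U_n$. ONE wins the play if $X\subseteq\bigcup_{n\in\omega}U_n$; otherwise TWO wins. A strategy for a player is a function assigning a legal move to each finite sequence of the opponent's previous moves (for TWO, including the opponent's current move); it is winning if the player wins every play in which it is followed. Two games $G$ and $G'$ are equivalent if ONE has a winning strategy in $G$ if and only if ONE has a winning strategy in $G'$, and TWO has a winning strategy in $G$ if and only if TWO has a winning strategy in $G'$. *)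

(* Defs.v *)
From mathcomp Require Import all_boot all_order.
From mathcomp Require Import all_classical topology.
From Stdlib Require List.

Set Implicit Arguments.
Unset Strict Implicit.
Unset Printing Implicit Defensive.

Local Open Scope classical_set_scope.

(* Two-player games of length omega in which ONE moves first in each inning,
   and the legality of TWO's move depends only on ONE's move in that inning. *)
Record game := Game {
  move1 : Type;
  move2 : Type;
  legal1 : move1 -> Prop;
  legal2 : move1 -> move2 -> Prop;
  wins1 : (nat -> move1) -> (nat -> move2) -> Prop
}.

Section Strategies.
Variable G : game.
Implicit Types (sigma : seq (move2 G) -> move1 G)
  (tau : seq (move1 G) -> move2 G).

(* sigma is applied to the list of TWO's previous moves, oldest first. Only
   histories that can arise while sigma is followed are required to get a legal
   answer; sigma takes arbitrary values on the others. *)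
Definition strategy1 sigma : Prop :=
  forall s : seq (move2 G),
    (forall p b q, s = p ++ b :: q -> legal2 (sigma p) b) ->
    legal1 (sigma s).

(* tau is applied to the list of ONE's previous moves followed by ONE's current
   move. *)
Definition strategy2 tau : Prop :=
  forall (s : seq (move1 G)) (a : move1 G),
    List.Forall (@legal1 G) (rcons s a) -> legal2 a (tau (rcons s a)).

Definition play (a : nat -> move1 G) (b : nat -> move2 G) : Prop :=
  forall n, legal1 (a n) /\ legal2 (a n) (b n).

Definition winning_strategy1 sigma : Prop :=
  strategy1 sigma /\
  forall a b, play a b -> (forall n, a n = sigma (mkseq b n)) -> wins1 a b.

Definition winning_strategy2 tau : Prop :=
  strategy2 tau /\
  forall a b, play a b -> (forall n, b n = tau (mkseq a n.+1)) -> ~ wins1 a b.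

Definition one_has_winning_strategy : Prop :=
  exists sigma, winning_strategy1 sigma.

Definition two_has_winning_strategy : Prop :=
  exists tau, winning_strategy2 tau.

End Strategies.

Definition equivalent_games (G H : game) : Prop :=
  (one_has_winning_strategy G <-> one_has_winning_strategy H) /\
  (two_has_winning_strategy G <-> two_has_winning_strategy H).

Section CoverGames.
Variable X : topologicalType.

Definition quasi_component_of (K F : set X) : Prop :=
  F = \bigcap_(U in [set U : set X | clopen U /\ K `<=` U]) U.

Definition compact_clopen_game : game := {|
  move1 := set X;
  move2 := set X;
  legal1 := fun K => compact K;
  legal2 := fun K U => clopen U /\ K `<=` U;
  wins1 := fun _ U => [set: X] `<=` \bigcup_n U n
|}.

Definition quasi_component_clopen_game : game := {|
  move1 := set X;
  move2 := set X;
  legal1 := fun A => exists K : set X, compact K /\ quasi_component_of K A;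
  legal2 := fun A U => clopen U /\ A `<=` U;
  wins1 := fun _ U => [set: X] `<=` \bigcup_n U n
|}.

End CoverGames.

(* Main.v *)
(* Every clopen set containing a compact set K also contains its quasi-component
   and conversely, so K and its quasi-component allow TWO the same answers.
   Translating ONE's moves by K |-> quasi-component of K, and backwards by a
   choice of K, therefore transfers strategies of both players. *)
Require Import Defs.
From mathcomp Require Import all_boot all_order.
From mathcomp Require Import all_classical topology.
From Stdlib Require List.

Set Implicit Arguments.
Unset Strict Implicit.
Unset Printing Implicit Defensive.

Local Open Scope classical_set_scope.

Section Translation.
Variables (M N B : Type) (l1 : M -> Prop) (l2 : M -> B -> Prop).
Variables (w : (nat -> M) -> (nat -> B) -> Prop).
Variables (l1' : N -> Prop) (l2' : N -> B -> Prop).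
Variables (w' : (nat -> N) -> (nat -> B) -> Prop).
Variable f : M -> N.
(** A one-sided simulation: moves of ONE go from [G] to [H] along [f], while answers of TWO come
    back unchanged. The premise [l1 a] in [f_legal2] allows for an [f] that is controlled only on
    legal moves. *)
Hypothesis f_legal1 : forall a, l1 a -> l1' (f a).
Hypothesis f_legal2 : forall a b, l1 a -> l2' (f a) b -> l2 a b.
Hypothesis f_wins1 : forall a b, w a b -> w' (f \o a) b.

Let G := Game l1 l2 w.
Let H := Game l1' l2' w'.

(** The answers are legal only against the translated moves. [f_legal2] pulls this back once
    [sigma p] is known to be legal, which is the same claim for the shorter history [p]; hence
    strong induction on length. *)
Lemma strategy1_translation (sigma : seq B -> M) :
  @strategy1 G sigma -> forall s,
  (forall p b q, s = p ++ b :: q -> l2' (f (sigma p)) b) -> l1 (sigma s).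
Proof.
move=> sigmaP s; have [n] := ubnP (size s).
elim: n s => // n IHn s lt_s_n s_legal; apply: sigmaP => p b q s_pbq.
apply: f_legal2 (s_legal _ _ _ s_pbq); apply: IHn.
  by rewrite -ltnS; apply: leq_trans lt_s_n; rewrite s_pbq size_cat /= addnS !ltnS leq_addr.
move=> p1 b1 q1 p_eq; apply: (s_legal p1 b1 (q1 ++ b :: q)).
by rewrite s_pbq p_eq -catA.
Qed.

Lemma one_winning_translation :
  one_has_winning_strategy G -> one_has_winning_strategy H.
Proof.
case=> sigma [sigmaP sigma_wins]; exists (f \o sigma); split=> [s s_legal|a b ab_play a_sigma].
  exact/f_legal1/(strategy1_translation sigmaP).
have sigma_legal n : l1 (sigma (mkseq b n)).
  apply: strategy1_translation => // p c q b_pcq.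
  have lt_p_n : size p < n.
    by rewrite -(size_mkseq b n) b_pcq size_cat /= addnS ltnS leq_addr.
  (* A prefix of the history is itself a history of the same play, so legality of [c] is the inning
     [size p] of [ab_play]. *)
  have p_mkseq : p = mkseq b (size p).
    by rewrite -(take_size_cat (c :: q) (erefl (size p))) -b_pcq -map_take
      take_iota (minn_idPl (ltnW lt_p_n)) size_map size_iota.
  have -> : c = b (size p).
    have := congr1 (nth c ^~ (size p)) b_pcq.
    by rewrite nth_mkseq // nth_cat ltnn subnn.
  by have [_] := ab_play (size p); rewrite a_sigma /= -p_mkseq.
have -> : a = f \o (fun n => sigma (mkseq b n)) by apply/funext => n; exact: a_sigma.
apply: f_wins1; apply: sigma_wins => // n; split; first exact: sigma_legal.
by apply: f_legal2 => //; have [_] := ab_play n; rewrite a_sigma.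
Qed.

Lemma Forall_legal_map s : List.Forall l1 s -> List.Forall l1' (map f s).
Proof. by elim=> [|a s' ? ? ?] /=; constructor=> //; exact: f_legal1. Qed.

(** Strategies of TWO travel against [f]: TWO translates the moves of ONE and answers as in [H]. A
    win of ONE in [G] would then give one in [H]. *)
Lemma two_winning_translation :
  two_has_winning_strategy H -> two_has_winning_strategy G.
Proof.
case=> tau [tauP tau_wins]; exists (tau \o map f); split=> [s a sa_legal|a b ab_play b_tau].
  have sa_legal' := Forall_legal_map sa_legal.
  have /List.Forall_forall a_legal := sa_legal.
  apply: f_legal2; last by rewrite /= map_rcons; apply: tauP; rewrite -map_rcons.
  by apply: a_legal; elim: (s) => [|c s' IHs]; [left | right].
have b_tau' n : b n = tau (mkseq (f \o a) n.+1) by rewrite b_tau /= /mkseq map_comp.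
move=> /f_wins1; apply: tau_wins => // n.
have fa_legal m : l1' (f (a m)) by apply: f_legal1; case: (ab_play m).
split; first exact: fa_legal.
rewrite b_tau' mkseqS; apply: tauP; rewrite -mkseqS /mkseq.
by elim: (iota 0 n.+1) => [|i s IHs] /=; constructor => //; exact: fa_legal.
Qed.

End Translation.

Section QuasiComponent.
Variable X : topologicalType.
Implicit Types K A U : set X.

Lemma quasi_component_of_subset K A U :
  quasi_component_of K A -> clopen U -> (A `<=` U) <-> (K `<=` U).
Proof.
move=> -> U_clopen; split=> [A_U x Kx|K_U x]; last exact.
by apply: A_U => V [_]; exact.
Qed.

(** Different compact sets can share a quasi-component, so a compact set has to be chosen for each
    [A]. *)
Lemma quasi_component_compact_choice :
  exists k : set X -> set X, forall A,
    (exists K, compact K /\ quasi_component_of K A) ->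
    compact (k A) /\ quasi_component_of (k A) A.
Proof.
have choose A : exists K', (exists K, compact K /\ quasi_component_of K A) ->
    compact K' /\ quasi_component_of K' A.
  have [[K KA]|noK] := pselect (exists K, compact K /\ quasi_component_of K A).
    by exists K.
  (* Arbitrary value, for an [A] that is not a legal move. *)
  by exists set0.
by have [k kP] := choice choose; exists k.
Qed.

End QuasiComponent.

Theorem proposition4p1 (X : topologicalType) :
  equivalent_games (compact_clopen_game X) (quasi_component_clopen_game X).
Proof.
pose q (K : set X) := \bigcap_(U in [set U | clopen U /\ K `<=` U]) U.
have qP K : quasi_component_of K (q K) by [].
have q_legal1 K : compact K -> exists L, compact L /\ quasi_component_of L (q K).
  by exists K.
have q_legal2 K U : compact K -> clopen U /\ q K `<=` U -> clopen U /\ K `<=` U.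
  by move=> _ [U_clopen /(quasi_component_of_subset (qP K) U_clopen)].
have [k kP] := quasi_component_compact_choice X.
have k_legal1 A : (exists K, compact K /\ quasi_component_of K A) -> compact (k A).
  by case/kP.
have k_legal2 A U : (exists K, compact K /\ quasi_component_of K A) ->
    clopen U /\ k A `<=` U -> clopen U /\ A `<=` U.
  by move=> /kP[_ kA] [U_clopen /(quasi_component_of_subset kA U_clopen)].
(* Winning is the same condition on TWO's sets in both games, so [f_wins1] is immediate. For TWO the
   roles of [q] and [k] are swapped. *)
split; split.
- exact: (one_winning_translation q_legal1 q_legal2).
- exact: (one_winning_translation k_legal1 k_legal2).
- exact: (two_winning_translation k_legal1 k_legal2).
- exact: (two_winning_translation q_legal1 q_legal2).
Qed.
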